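(* There exist absolute constants $a>1$ and $c>0$ such that for every $n\geq 1$ and every $p$ in the range $1\leq p <\infty$, \[ c_{\gamma_n,p} \geq c\, a^{n/p}. \]
   Context: $B(x,R)$ denotes the Euclidean ball in $\mathbb{R}^n$ centred at $x$ with radius $R$. For a Radon measure $\mu$ on $\mathbb{R}^n$, the associated maximal function is \[ M_\mu g(x)=\sup_{R>0,\ \mu(B(x,R))>0}\frac1{\mu(B(x,R))}\int_{B(x,R)}|g(y)|\,d\mu(y). \] For $1\le p<\infty$, $c_{\mu,p}$ denotes the best (smallest) constant $c$ such that $\mu(\{y\in\mathbb{R}^n: M_\mu g(y)>\lambda\})^{1/p}\leq \frac{c}{\lambda}\|g\|_{L^p(\mu)}$ for all $\lambda>0$ and all $g\in L^p(\mu)$. $\gamma_n$ is the Gaussian measure on $\mathbb{R}^n$ given by $d\gamma_n(x)=e^{-\pi|x|^2}\,dx$. *)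

(* Defs.v *)
From HB Require Import structures.
From mathcomp Require Import all_boot all_order all_algebra.
From mathcomp Require Import all_classical all_reals all_analysis.
From mathcomp Require Import measurable_realfun.

Set Implicit Arguments.
Unset Strict Implicit.
Unset Printing Implicit Defensive.

Import Order.TTheory GRing.Theory Num.Theory.
Import numFieldNormedType.Exports.

Local Open Scope classical_set_scope.
Local Open Scope ring_scope.
Local Open Scope ereal_scope.

(* R^n is [n.-tuple (measurableTypeR R)]: the library equips it with the
   product sigma-algebra of the Borel sets of R, i.e. the Borel sets of R^n.
   The library has no Lebesgue measure there; it is built below by induction
   on n. *)

Section lebesgue_step.
Context {R : realType} (n : nat).
Variable mu : {sigma_finite_measure set (n.-tuple (measurableTypeR R)) -> \bar R}.

Definition tcons (z : measurableTypeR R * n.-tuple (measurableTypeR R)) :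
  n.+1.-tuple (measurableTypeR R) := [tuple of z.1 :: z.2].

Lemma measurable_tcons : measurable_fun [set: _] tcons.
Proof. exact: measurable_cons. Qed.

Definition lebesgue_step : set (n.+1.-tuple (measurableTypeR R)) -> \bar R :=
  pushforward (@lebesgue_measure R \x mu) tcons.

Let step0 : lebesgue_step set0 = 0.
Proof. by rewrite /lebesgue_step /pushforward preimage_set0 measure0. Qed.

Let step_ge0 A : 0 <= lebesgue_step A.
Proof. exact: (@measure_ge0 _ _ _ (@lebesgue_measure R \x mu)). Qed.

Let step_sigma_additive : semi_sigma_additive lebesgue_step.
Proof.
move=> F mF tF mUF; rewrite /lebesgue_step.
exact: (@measure_semi_sigma_additive _ _ _
  (measure_function_pushforward__canonical__measure_function_Measure
    (@lebesgue_measure R \x mu) measurable_tcons) F mF tF mUF).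
Qed.

HB.instance Definition _ := isMeasure.Build _ _ _ lebesgue_step
  step0 step_ge0 step_sigma_additive.

Let step_sigma_finite : sigma_finite [set: _] lebesgue_step.
Proof.
have /sigma_finiteP[F [FT ndF mF]] := sigma_finiteT (@lebesgue_measure R).
have /sigma_finiteP[G [GT ndG mG]] := sigma_finiteT mu.
pose unc (t : n.+1.-tuple (measurableTypeR R)) := (thead t, [tuple of behead t]).
have munc : measurable_fun [set: _] unc.
  apply: measurable_fun_pair; first exact: measurable_tnth.
  exact: measurable_behead.
exists (fun i => unc @^-1` (F i `*` G i)).
  apply/seteqP; split=> // t _.
  have : [set: _] (unc t).1 by [].
  have : [set: _] (unc t).2 by [].
  rewrite FT GT => -[i _ Gi] [j _ Fj]; exists (maxn i j) => //; split.
  - by move: Fj; apply/subsetPset/ndF/leq_maxr.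
  - by move: Gi; apply/subsetPset/ndG/leq_maxl.
move=> i; have [mFi Fioo] := mF i; have [mGi Gioo] := mG i; split.
  by rewrite -[X in measurable X]setTI; apply: munc => //; exact: measurableX.
rewrite /= /lebesgue_step /pushforward.
rewrite (_ : tcons @^-1` _ = F i `*` G i).
  by rewrite product_measure1E// lte_mul_pinfty// ge0_fin_numE.
have tconsK z : unc (tcons z) = z.
  by case: z => x t; congr pair; exact/val_inj.
by rewrite -comp_preimage (_ : unc \o tcons = id)//; exact/funext.
Qed.

HB.instance Definition _ := Measure_isSigmaFinite.Build _ _ _ lebesgue_step
  step_sigma_finite.

End lebesgue_step.

(* [lebesgue_Rn 0] is the unit mass of the one-point space R^0, and
   [lebesgue_Rn n.+1] is the product of [lebesgue_measure] and [lebesgue_Rn n],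
   transported along R * R^n = R^n.+1. *)
Fixpoint lebesgue_Rn (R : realType) (n : nat) :
    {sigma_finite_measure set (n.-tuple (measurableTypeR R)) -> \bar R} :=
  match n with
  | 0%N => dirac [tuple]
  | m.+1 => lebesgue_step (lebesgue_Rn R m)
  end.

Section euclidean.
Context {R : realType} (n : nat).
Implicit Types x y : n.-tuple (measurableTypeR R).

Definition enorm x : R := Num.sqrt (\sum_(i < n) tnth x i ^+ 2).

Definition edist x y : R := Num.sqrt (\sum_(i < n) (tnth x i - tnth y i) ^+ 2).

(* the library's [ball] on product types is the one of the sup norm *)
Definition eball x (r : R) : set (n.-tuple (measurableTypeR R)) :=
  [set y | (edist x y < r)%R].

End euclidean.

Section gaussian_measure.
Context (R : realType) (n : nat).

Definition gaussian_density (x : n.-tuple (measurableTypeR R)) : R :=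
  expR (- (pi * enorm x ^+ 2)).

Definition gaussian_Rn (A : set (n.-tuple (measurableTypeR R))) : \bar R :=
  \int[lebesgue_Rn R n]_(x in A) (gaussian_density x)%:E.

Lemma measurable_gaussian_density : measurable_fun [set: _] gaussian_density.
Proof.
apply: measurableT_comp => //; apply: measurableT_comp => //.
apply: measurable_funM => //.
rewrite (_ : (fun x => _) =
    fun x : n.-tuple (measurableTypeR R) => (\sum_(i < n) tnth x i ^+ 2)%R).
  apply: measurable_sum => i.
  by apply: measurable_funX; exact: measurable_tnth.
by apply/funext => x; rewrite sqr_sqrtr// sumr_ge0// => i _; rewrite sqr_ge0.
Qed.

Let gaussian0 : gaussian_Rn set0 = 0.
Proof. by rewrite /gaussian_Rn integral_set0. Qed.

Let gaussian_ge0 A : 0 <= gaussian_Rn A.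
Proof. by apply: integral_ge0 => x _; rewrite lee_fin expR_ge0. Qed.

Let gaussian_sigma_additive : semi_sigma_additive gaussian_Rn.
Proof.
move=> F mF tF mUF; rewrite /gaussian_Rn ge0_integral_bigcup//.
- apply: is_cvg_ereal_nneg_natsum_cond => k _ _.
  by apply: integral_ge0 => x _; rewrite lee_fin expR_ge0.
- apply: measurable_funTS; apply/measurable_EFinP.
  exact: measurable_gaussian_density.
- by move=> x _; rewrite lee_fin expR_ge0.
Qed.

HB.instance Definition _ := isMeasure.Build _ _ _ gaussian_Rn
  gaussian0 gaussian_ge0 gaussian_sigma_additive.

End gaussian_measure.
Arguments gaussian_Rn : clear implicits.

Section maximal_function.
Context {R : realType} (n : nat).
Variable mu : {measure set (n.-tuple (measurableTypeR R)) -> \bar R}.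

(* [ereal_sup] of an empty set is -oo; this occurs only when [mu] is zero on
   every ball, in particular not for [gaussian_Rn]. *)
Definition maximal (g : n.-tuple (measurableTypeR R) -> R)
    (x : n.-tuple (measurableTypeR R)) : \bar R :=
  ereal_sup [set (mu (eball x r))^-1 * \int[mu]_(y in eball x r) `|g y|%:E
            | r in [set r : R | (0 < r)%R /\ 0 < mu (eball x r)]].

Definition weak_type_bound (p c : R) :=
  forall (lambda : R) (g : n.-tuple (measurableTypeR R) -> R),
    (0 < lambda)%R -> g \in Lfun mu p%:E ->
    mu [set y | lambda%:E < maximal g y] `^ p^-1 <=
    (c / lambda)%:E * 'N[mu]_(p%:E) [EFin \o g].

(* The infimum is over real constants; it is attained when there is one, and
   is +oo when no finite constant works. *)
Definition weak_type_const (p : R) : \bar R :=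
  ereal_inf [set c%:E | c in [set c : R | (0 <= c)%R /\ weak_type_bound p c]].

End maximal_function.

(* Main.v *)
Require Import Defs.
From HB Require Import structures.
From mathcomp Require Import all_boot all_order all_algebra.
From mathcomp Require Import all_classical all_reals all_analysis.
From mathcomp Require Import measurable_realfun.
From mathcomp Require Import ring lra.

Set Implicit Arguments.
Unset Strict Implicit.
Unset Printing Implicit Defensive.

Import Order.TTheory GRing.Theory Num.Theory.
Import numFieldNormedType.Exports.

Local Open Scope classical_set_scope.
Local Open Scope ring_scope.

(* Measure squared radii in units where [pi * |y|^2 = m := n / 2] is the typical
   Gaussian value.  Let A be the centred ball [pi * |y|^2 < 0.99 m], whose
   Gaussian measure is exponentially small, and let x be typical, i.e.
   [pi * |x|^2] close to m.  The ball D about x with [pi * |x - y|^2 < 0.76 m] has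
   at least half of its Gaussian mass in A: tilting the Gaussian measure on D by
   [exp(- pi |x - y|^2)] yields a Gaussian centred at x / 2, under which both
   [pi * |y|^2] and [pi * |x - y|^2] concentrate near [3 m / 4].  Hence the maximal
   function of the indicator of A is at least 1/2 on a set of measure at least
   1/2.  All concentration estimates are Chernoff bounds, i.e. exact evaluations
   of [\int exp(- pi (a |y|^2 + b |x - y|^2)) dy], which tensorize.  Small n is
   covered by the indicator of the whole space. *)

(** * Gaussian integrals *)

Definition sqn {R : realType} {n : nat} (y : n.-tuple (measurableTypeR R)) : R :=
  \sum_(i < n) tnth y i ^+ 2.

Definition sqd {R : realType} {n : nat} (x y : n.-tuple (measurableTypeR R)) : R :=
  \sum_(i < n) (tnth x i - tnth y i) ^+ 2.

Lemma sqn_ge0 {R : realType} {n} (y : n.-tuple (measurableTypeR R)) : 0 <= sqn y.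
Proof. by apply: sumr_ge0 => i _; rewrite sqr_ge0. Qed.

Lemma measurable_sqn {R : realType} {n} :
  measurable_fun setT (@sqn R n).
Proof.
by apply: measurable_sum => i; apply: measurable_funX; exact: measurable_tnth.
Qed.

Lemma measurable_sqd {R : realType} {n} (x : n.-tuple (measurableTypeR R)) :
  measurable_fun setT (sqd x).
Proof.
apply: measurable_sum => i; apply: measurable_funX; apply: measurable_funB => //.
exact: measurable_tnth.
Qed.

(** With [a = 1] and [b = 0] this is the Gaussian density; [a = b = 1] gives the density tilted
    towards [x]. Shifting either coefficient produces the exponential moments of [sqn] and
    [sqd x]. *)
Definition gauss2 {R : realType} {n : nat} (a b : R)
    (x y : n.-tuple (measurableTypeR R)) : R :=
  expR (- (pi * (a * sqn y + b * sqd x y))).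

Lemma measurable_gauss2 {R : realType} {n} (a b : R) (x : n.-tuple (measurableTypeR R)) :
  measurable_fun setT (gauss2 a b x).
Proof.
apply: measurableT_comp => //; apply: measurableT_comp => //.
apply: measurable_funM => //; apply: measurable_funD; apply: measurable_funM => //.
  exact: measurable_sqn.
exact: measurable_sqd.
Qed.

(** Total mass of [gauss2 a b x], read off from [a |y|^2 + b |x - y|^2 = (a + b) |y - b x / (a +
    b)|^2 + (a b / (a + b)) |x|^2]. *)
Definition gauss2_mass {R : realType} {n : nat} (a b : R)
    (x : n.-tuple (measurableTypeR R)) : R :=
  (Num.sqrt (a + b))^-1 ^+ n * expR (- (pi * (a * b / (a + b) * sqn x))).

(** Completing the square exhibits the integrand as a multiple of the normal density of mean
    [b x / (a + b)] and variance [1 / (2 pi (a + b))]. *)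
Lemma integral_gauss1 (R : realType) (a b x : R) : 0 < a + b ->
  (\int[@lebesgue_measure R]_y
    (expR (- (pi * (a * y ^+ 2 + b * (x - y) ^+ 2))))%:E =
  ((Num.sqrt (a + b))^-1 * expR (- (pi * (a * b / (a + b) * x ^+ 2))))%:E)%E.
Proof.
move=> ab0; set k := (_ * _ in RHS).
have k0 : 0 <= k by rewrite mulr_ge0 ?invr_ge0 ?sqrtr_ge0 ?expR_ge0.
have pi0 : (0 : R) < pi by exact: pi_gt0.
pose s := Num.sqrt ((2 * pi * (a + b))^-1).
have c0 : 0 < (2 * pi * (a + b))^-1 by rewrite invr_gt0 !mulr_gt0.
have s0 : s != 0 by rewrite gt_eqF// sqrtr_gt0.
have s2 : s ^+ 2 = (2 * pi * (a + b))^-1 by rewrite sqr_sqrtr// ltW.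
rewrite -[RHS]mule1 -(integral_normal_pdf (b * x / (a + b)) s).
rewrite -ge0_integralZl//; last 2 first.
- by apply/measurable_EFinP; exact: measurable_normal_pdf.
- by move=> y _; rewrite lee_fin normal_pdf_ge0.
apply: eq_integral => y _; rewrite -EFinM; congr EFin.
rewrite normal_pdfE// /normal_peak /normal_fun s2 /k.
(* [pi] is generalized because [field] would unfold it. *)
have -> : (2 * pi * (a + b))^-1 * pi *+ 2 = (a + b)^-1.
  by move: (@pi R) pi0 => P P0; field; rewrite !gt_eqF.
rewrite sqrtrV; last exact: ltW.
rewrite invrK mulrACA mulVf ?mul1r ?gt_eqF ?sqrtr_gt0//.
rewrite -expRD; congr expR.
by move: (@pi R) pi0 => P P0; field;
  rewrite ?invr_eq0 ?mulf_neq0 ?gt_eqF ?invr_gt0 ?mulr_gt0.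
Qed.

Lemma tnth_tcons0 (R : realType) n (u : measurableTypeR R) (t : n.-tuple (measurableTypeR R)) :
  tnth (tcons (u, t)) ord0 = u.
Proof. by []. Qed.

Lemma tnth_tconsS (R : realType) n (u : measurableTypeR R) (t : n.-tuple (measurableTypeR R)) i :
  tnth (tcons (u, t)) (lift ord0 i) = tnth t i.
Proof. by rewrite !(tnth_nth u). Qed.

Lemma gauss2_tcons (R : realType) n (a b u v : R) (s t : n.-tuple (measurableTypeR R)) :
  gauss2 a b (tcons (u, s)) (tcons (v, t)) =
  expR (- (pi * (a * v ^+ 2 + b * (u - v) ^+ 2))) * gauss2 a b s t.
Proof.
rewrite /gauss2 -expRD; congr expR; rewrite /sqn /sqd !big_ord_recl.
rewrite !tnth_tcons0.
under eq_bigr do rewrite tnth_tconsS.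
under [X in b * (_ + X)]eq_bigr do rewrite !tnth_tconsS.
ring.
Qed.

Lemma sqn_tcons (R : realType) n (u : R) (s : n.-tuple (measurableTypeR R)) :
  sqn (tcons (u, s)) = u ^+ 2 + sqn s.
Proof.
rewrite /sqn big_ord_recl tnth_tcons0; congr (_ + _).
by apply: eq_bigr => i _; rewrite tnth_tconsS.
Qed.

(** The weight is a product over coordinates, so Tonelli splits off one coordinate at each step of
    the induction. *)
Lemma integral_gauss2 (R : realType) (n : nat) (a b : R)
    (x : n.-tuple (measurableTypeR R)) : 0 < a + b ->
  (\int[lebesgue_Rn R n]_y (gauss2 a b x y)%:E = (gauss2_mass a b x)%:E)%E.
Proof.
move=> ab0; elim: n x => [|n IH] x.
  rewrite /= integral_dirac//; last first.
    by apply/measurable_EFinP; exact: measurable_gauss2.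
  rewrite diracT mul1e /gauss2_mass /gauss2 /sqn /sqd.
  by rewrite !big_ord0 !mulr0 addr0 mulr0 expr0 mul1r.
have [u [s ->]] : exists u s, x = tcons (u, s).
  by case/tupleP: x => u s; exists u, s; exact/val_inj.
rewrite /= /lebesgue_step ge0_integral_pushforward//=; last 3 first.
- exact: measurable_tcons.
- by apply/measurable_EFinP; exact: measurable_gauss2.
- by move=> y _; rewrite lee_fin expR_ge0.
rewrite preimage_setT.
rewrite (@fubini_tonelli1 _ _ _ _ _ _ _
  (fun z => (gauss2 a b (tcons (u, s)) (tcons z))%:E))//=; last 2 first.
- apply/measurable_EFinP; exact: (measurableT_comp
    (@measurable_gauss2 R n.+1 a b (tcons (u, s))) (@measurable_tcons R n)).
- by move=> y; rewrite lee_fin expR_ge0.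
rewrite /fubini_F.
transitivity (\int[@lebesgue_measure R]_v ((gauss2_mass a b s)%:E *
   (expR (- (pi * (a * v ^+ 2 + b * (u - v) ^+ 2))))%:E))%E.
  apply: eq_integral => v _ /=.
  under eq_integral do rewrite gauss2_tcons EFinM.
  rewrite ge0_integralZl//; last 2 first.
  - by apply/measurable_EFinP; exact: measurable_gauss2.
  - by move=> y _; rewrite lee_fin expR_ge0.
  by rewrite muleC IH.
rewrite ge0_integralZl//; last 2 first.
- apply/measurable_EFinP; apply: measurableT_comp => //.
  apply: measurableT_comp => //; apply: measurable_funM => //.
  apply: measurable_funD; apply: measurable_funM => //; apply: measurable_funX => //.
  exact: measurable_funB.
- by rewrite lee_fin mulr_ge0 ?expR_ge0// exprn_ge0// invr_ge0 sqrtr_ge0.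
rewrite integral_gauss1// -EFinM; congr EFin.
rewrite /gauss2_mass sqn_tcons !mulrDr opprD expRD.
by rewrite (exprS _ n); move: (_^-1 ^+ n) => ?; ring.
Qed.

Lemma gauss2_ge0 {R : realType} {n} (a b : R) (x y : n.-tuple (measurableTypeR R)) :
  0 <= gauss2 a b x y.
Proof. exact: expR_ge0. Qed.

Lemma gauss2_mass_gt0 {R : realType} {n} (a b : R) (x : n.-tuple (measurableTypeR R)) :
  0 < a + b -> 0 < gauss2_mass a b x.
Proof.
by move=> ab0; rewrite mulr_gt0 ?expR_gt0// exprn_gt0// invr_gt0 sqrtr_gt0.
Qed.

Lemma gauss2_massC {R : realType} {n} (a b : R) (x : n.-tuple (measurableTypeR R)) :
  gauss2_mass a b x = gauss2_mass b a x.
Proof. by rewrite /gauss2_mass addrC [a * b]mulrC. Qed.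

(** As [b = 0], the point [x] is arbitrary; it is chosen to match the tilted weight it is compared
    with. *)
Lemma gaussian_RnE {R : realType} {n} (x : n.-tuple (measurableTypeR R)) A :
  (gaussian_Rn R n A = \int[lebesgue_Rn R n]_(y in A) (gauss2 1 0 x y)%:E)%E.
Proof.
rewrite /gaussian_Rn; apply: eq_integral => y _; congr EFin.
rewrite /gaussian_density /gauss2 mul1r mul0r addr0 /enorm sqr_sqrtr//.
exact: sqn_ge0.
Qed.

(** * Comparison of Gaussian weights and estimates of their masses *)

Section comparison.
Context {R : realType} {n : nat} (a b a' b' c : R) (x : n.-tuple (measurableTypeR R)).
Variable S : set (n.-tuple (measurableTypeR R)).
Hypothesis mS : measurable S.
Hypothesis dom : forall y, S y ->
  pi * (a' * sqn y + b' * sqd x y) + c <= pi * (a * sqn y + b * sqd x y).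

(** Serves two purposes: Chernoff bounds, and passing between the Gaussian and the tilted weight on
    sets where [sqd x] is controlled. *)
Lemma le_integral_gauss2 :
  (\int[lebesgue_Rn R n]_(y in S) (gauss2 a b x y)%:E <=
   (expR (- c))%:E * \int[lebesgue_Rn R n]_(y in S) (gauss2 a' b' x y)%:E)%E.
Proof.
rewrite -ge0_integralZl//; last 2 first.
- by apply/measurable_funTS/measurable_EFinP; exact: measurable_gauss2.
- by move=> y _; rewrite lee_fin gauss2_ge0.
apply: ge0_le_integral => //.
- by move=> y _; rewrite lee_fin gauss2_ge0.
- by apply/measurable_funTS/measurable_EFinP; exact: measurable_gauss2.
- apply/measurable_funTS/measurable_EFinP; apply: measurable_funM => //.
  exact: measurable_gauss2.
- move=> y Sy; rewrite -EFinM lee_fin /gauss2 -expRD ler_expR.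
  by have := dom Sy; lra.
Qed.

(** Enlarging [S] to the whole space on the right makes the Chernoff bound explicit. *)
Lemma le_integral_gauss2_mass : 0 < a' + b' ->
  (\int[lebesgue_Rn R n]_(y in S) (gauss2 a b x y)%:E <=
   (expR (- c) * gauss2_mass a' b' x)%:E)%E.
Proof.
move=> ab0; apply: (le_trans le_integral_gauss2).
rewrite EFinM lee_pmul2l ?fin_numE// ?lte_fin ?expR_gt0//.
rewrite -integral_gauss2//; apply: ge0_subset_integral => //.
- by apply/measurable_EFinP; exact: measurable_gauss2.
- by move=> y _; rewrite lee_fin gauss2_ge0.
Qed.

End comparison.

(** Apply [e^u >= 1 + u] at [u = (t + t^2) / 2] and square: [(1 - t) (1 + u)^2] exceeds 1 by
    [t^2 ((1 + t)^2 (1 - t) / 4 - t)], which is nonnegative for [|t| <= 1 / 4]. *)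
Lemma inv_sqrt_le_expR {R : realType} (t : R) : `|t| <= 1 / 4 ->
  (Num.sqrt (1 - t))^-1 <= expR ((t + t ^+ 2) / 2).
Proof.
rewrite ler_norml => /andP[tl tu].
have h : 1 <= (1 - t) * expR ((t + t ^+ 2) / 2) ^+ 2.
  set e := expR _.
  have e1 : 1 + (t + t ^+ 2) / 2 <= e by exact: expR_ge1Dx.
  have e0 : 0 <= 1 + (t + t ^+ 2) / 2 by nra.
  have e2 : (1 + (t + t ^+ 2) / 2) ^+ 2 <= e ^+ 2 by rewrite lerXn2r ?nnegrE//; lra.
  apply: (@le_trans _ _ ((1 - t) * (1 + (t + t ^+ 2) / 2) ^+ 2)); last first.
    by apply: ler_wpM2l => //; lra.
  have -> : (1 - t) * (1 + (t + t ^+ 2) / 2) ^+ 2 =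
    1 + t ^+ 2 * ((1 + t) ^+ 2 * (1 - t) / 4 - t) by field.
  rewrite lerDl mulr_ge0 ?sqr_ge0//.
  have := sqr_ge0 t; nra.
have s0 : 0 < Num.sqrt (1 - t) by rewrite sqrtr_gt0; lra.
rewrite -[_^-1]mul1r ler_pdivrMr// -(@ler_pXn2r _ 2) ?nnegrE//.
rewrite expr1n exprMn sqr_sqrtr; last by lra.
by rewrite mulrC.
Qed.

Lemma gauss2_mass10 {R : realType} {n} (x : n.-tuple (measurableTypeR R)) :
  gauss2_mass 1 0 x = 1.
Proof.
by rewrite /gauss2_mass addr0 sqrtr1 invr1 expr1n mulr0 mul0r mul0r mulr0 oppr0 expR0 mul1r.
Qed.

(** The mass is [(1 - t)^(- n / 2)], the exponential moment of [t pi |y|^2] under the Gaussian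
    measure. *)
Lemma gauss2_mass_radial_le {R : realType} {n} (t : R)
    (x : n.-tuple (measurableTypeR R)) : `|t| <= 1 / 4 ->
  gauss2_mass (1 - t) 0 x <= expR (n%:R / 2 * (t + t ^+ 2)).
Proof.
move=> t4; rewrite /gauss2_mass addr0 mulr0 mul0r mul0r mulr0 oppr0 expR0 mulr1.
rewrite mulrAC -mulrA expRM_natl; apply: lerXn2r;
  rewrite ?nnegrE ?expR_ge0 ?invr_ge0 ?sqrtr_ge0//.
exact: inv_sqrt_le_expR.
Qed.

(** The normalization contributes [(1 - t)^(- n / 2)], and the coefficient of [|x|^2] drops from
    [1 / 2] by [w = t / (2 (1 - t))]. The linear term [3 / 2 * t] is [2 t] times [3 / 4], the tilted
    mean of [pi |y|^2] in units of [n / 2]. *)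
Lemma gauss2_mass_tilt_le {R : realType} {n} (eta t : R)
    (x : n.-tuple (measurableTypeR R)) :
  `|t| <= 1 / 4 -> `|pi * sqn x - n%:R / 2| <= eta * (n%:R / 2) ->
  gauss2_mass (1 - 2 * t) 1 x <=
  gauss2_mass 1 1 x * expR (n%:R / 2 * (3 / 2 * t + 2 * t ^+ 2 + eta * `|t|)).
Proof.
move=> t4 x_eta; have /andP[tl tu] : - (1 / 4) <= t <= 1 / 4 by rewrite -ler_norml.
have ms : (Num.sqrt (1 - 2 * t + 1))^-1 ^+ n <=
    (Num.sqrt (1 + 1))^-1 ^+ n * expR (n%:R / 2 * (t + t ^+ 2)).
  rewrite [n%:R / 2 * _]mulrAC -[n%:R * _ / _]mulrA expRM_natl -exprMn; apply: lerXn2r;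
    rewrite ?nnegrE ?mulr_ge0 ?expR_ge0 ?invr_ge0 ?sqrtr_ge0//.
  have -> : 1 - 2 * t + 1 = (1 + 1) * (1 - t) by ring.
  rewrite sqrtrM ?invfM; last by lra.
  apply: ler_wpM2l; first by rewrite invr_ge0 sqrtr_ge0.
  exact: inv_sqrt_le_expR.
rewrite /gauss2_mass.
set u := (1 + 1 : R).
apply: (le_trans (ler_wpM2r (expR_ge0 _) ms)).
rewrite -[leLHS]mulrA -[leRHS]mulrA.
apply: ler_wpM2l; first by rewrite exprn_ge0 ?invr_ge0 ?sqrtr_ge0.
rewrite -!expRD ler_expR.
have -> : (1 - 2 * t) * 1 / (1 - 2 * t + 1) = 1 / 2 - t / (2 * (1 - t)) by field; lra.
have -> : 1 * 1 / u = 1 / 2 by rewrite /u; field.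
set X := pi * sqn x in x_eta *.
rewrite mulrCA [pi * (_ * sqn x)]mulrCA -/X.
have n0 : 0 <= n%:R / 2 :> R by rewrite divr_ge0.
set m := n%:R / 2 in n0 x_eta *.
set w := t / (2 * (1 - t)).
have wE : w = t / 2 + t ^+ 2 * (2 * (1 - t))^-1 by rewrite /w; field; lra.
have i_le : (2 * (1 - t))^-1 <= 2 / 3 by rewrite invf_ple ?posrE; lra.
have i_ge : 0 <= (2 * (1 - t))^-1 by rewrite invr_ge0; lra.
have w1 : w <= t / 2 + 2 / 3 * t ^+ 2 by rewrite wE; have := sqr_ge0 t; nra.
have w2 : `|w| <= `|t|.
  rewrite /w normrM (ger0_norm i_ge); have := normr_ge0 t; nra.
(* Replacing [pi |x|^2] by its typical value [m] costs the term in [eta]. *)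
have w3 : w * (X - m) <= `|t| * (eta * m).
  apply: (le_trans (ler_norm _)); rewrite normrM.
  by apply: ler_pM.
have w4 : w * m <= (t / 2 + 2 / 3 * t ^+ 2) * m by apply: ler_wpM2r.
(* The quadratic terms add up to [(1 + 2 / 3) t^2 <= 2 t^2]. *)
have := mulr_ge0 n0 (sqr_ge0 t).
lra.
Qed.

(** * Chernoff bounds *)

Lemma ge0_integral_setU_le d (T : measurableType d) (R : realType)
    (mu : {measure set T -> \bar R}) (A B : set T) (f : T -> \bar R) :
  measurable A -> measurable B -> measurable_fun setT f ->
  (forall x, 0 <= f x)%E ->
  (\int[mu]_(x in A `|` B) f x <= \int[mu]_(x in A) f x + \int[mu]_(x in B) f x)%E.
Proof.
move=> mA mB mf f0.
have mBA : measurable (B `\` A) by exact: measurableD.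
have -> : A `|` B = A `|` (B `\` A) by rewrite setUDr setDv setD0.
rewrite ge0_integral_setU//; last 2 first.
- exact: measurable_funTS.
- by rewrite disj_set2E setDIK.
by rewrite leeD2l// ge0_subset_integral//; exact: measurable_funTS.
Qed.

Lemma measurable_lt_cst d (T : measurableType d) (R : realType) (f : T -> R) (c : R) :
  measurable_fun setT f -> measurable [set y | f y < c].
Proof.
move=> mf; have -> : [set y | f y < c] = setT `&` f @^-1` `]-oo, c[%classic.
  by rewrite setTI; apply/seteqP; split => y /=; rewrite in_itv.
exact: mf.
Qed.

Lemma measurable_ge_cst d (T : measurableType d) (R : realType) (f : T -> R) (c : R) :
  measurable_fun setT f -> measurable [set y | c <= f y].
Proof.
move=> mf; have -> : [set y | c <= f y] = ~` [set y | f y < c].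
  by apply/seteqP; split => y /=; rewrite leNgt => /negP.
by apply: measurableC; exact: measurable_lt_cst.
Qed.

Section tilted.
Context {R : realType} {n : nat} (x : n.-tuple (measurableTypeR R)).
Local Notation m := (n%:R / 2 : R).
Variables (eta t alpha : R) (S : set (n.-tuple (measurableTypeR R))).
Hypothesis mS : measurable S.
Hypothesis t4 : `|t| <= 1 / 4.
Hypothesis x_eta : `|pi * sqn x - m| <= eta * m.

Let bound_exponent : expR (- (2 * t * alpha * m)) *
    (gauss2_mass 1 1 x * expR (m * (3 / 2 * t + 2 * t ^+ 2 + eta * `|t|))) =
  gauss2_mass 1 1 x *
    expR (m * (3 / 2 * t + 2 * t ^+ 2 + eta * `|t| - 2 * t * alpha)).
Proof. by rewrite mulrCA -expRD; congr (_ * expR _); ring. Qed.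

(** On [S] the factor [exp(2 t (pi |y|^2 - alpha m))] is at least 1, and inserting it turns [a = 1]
    into [1 - 2 t]. The sign of [t] selects the tail: upper for [t > 0], lower for [t < 0]. *)
Lemma tilted_sqn_tail :
  (forall y, S y -> t * (alpha * m) <= t * (pi * sqn y)) ->
  (\int[lebesgue_Rn R n]_(y in S) (gauss2 1 1 x y)%:E <=
   (gauss2_mass 1 1 x *
    expR (m * (3 / 2 * t + 2 * t ^+ 2 + eta * `|t| - 2 * t * alpha)))%:E)%E.
Proof.
move=> hS; have /andP[tl tu] : - (1 / 4) <= t <= 1 / 4 by rewrite -ler_norml.
apply: (@le_trans _ _ (expR (- (2 * t * alpha * m)) * gauss2_mass (1 - 2 * t) 1 x)%:E).
  apply: le_integral_gauss2_mass => //; last by lra.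
  by move=> y /hS; lra.
rewrite lee_fin -bound_exponent; apply: ler_wpM2l; first exact: expR_ge0.
exact: gauss2_mass_tilt_le.
Qed.

(** Now the coefficient of [sqd x] is shifted; by [gauss2_massC] the mass estimate is the same. *)
Lemma tilted_sqd_tail :
  (forall y, S y -> t * (alpha * m) <= t * (pi * sqd x y)) ->
  (\int[lebesgue_Rn R n]_(y in S) (gauss2 1 1 x y)%:E <=
   (gauss2_mass 1 1 x *
    expR (m * (3 / 2 * t + 2 * t ^+ 2 + eta * `|t| - 2 * t * alpha)))%:E)%E.
Proof.
move=> hS; have /andP[tl tu] : - (1 / 4) <= t <= 1 / 4 by rewrite -ler_norml.
apply: (@le_trans _ _ (expR (- (2 * t * alpha * m)) * gauss2_mass 1 (1 - 2 * t) x)%:E).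
  apply: le_integral_gauss2_mass => //; last by lra.
  by move=> y /hS; lra.
rewrite lee_fin -bound_exponent gauss2_massC; apply: ler_wpM2l; first exact: expR_ge0.
exact: gauss2_mass_tilt_le.
Qed.

End tilted.

(* No measurability is assumed: this is applied to superlevel sets of the maximal
   function, and the integral is a supremum over simple functions below the
   integrand. *)
Lemma gaussian_Rn_subset {R : realType} {n} (A B : set (n.-tuple (measurableTypeR R))) :
  A `<=` B -> (gaussian_Rn R n A <= gaussian_Rn R n B)%E.
Proof.
move=> AB; rewrite /gaussian_Rn !ge0_integralE; last 2 first.
- by move=> x _; rewrite lee_fin expR_ge0.
- by move=> x _; rewrite lee_fin expR_ge0.
apply: ge_ereal_sup => _ [h /= hA <-]; apply: ereal_sup_ubound; exists h => //= y.
apply: (le_trans (hA y)); rewrite /patch; case: ifPn => yA.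
  by rewrite ifT//; apply/mem_set/AB/set_mem.
by case: ifP => // _; rewrite lee_fin expR_ge0.
Qed.

Lemma gaussian_Rn_setT (R : realType) n : gaussian_Rn R n setT = 1%E.
Proof.
rewrite (gaussian_RnE [tuple of nseq n 0]) integral_gauss2 ?gauss2_mass10//; lra.
Qed.

Lemma eball_sqrt (R : realType) n (x : n.-tuple (measurableTypeR R)) (c : R) : 0 < c ->
  eball x (Num.sqrt (c / pi)) = [set y | pi * sqd x y < c].
Proof.
move=> c0; have pi0 : (0 : R) < pi by exact: pi_gt0.
apply/seteqP; split=> y /=;
  by rewrite /eball/= /edist -/(sqd x y) ltr_sqrt ?divr_gt0// ltr_pdivlMr// mulrC.
Qed.

(** * Concentration and averages over balls in large dimension *)

Section large_dimension.
Context {R : realType} {n : nat}.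
Local Notation m := (n%:R / 2 : R).
(* All Chernoff exponents below are at most [- 6 * 10^-6 * m]; the constant is
   written with divisions since numerals are unary. *)
Local Notation q := (expR (- (m * (6 / 1000 / 1000)))).
Hypothesis q6 : q <= 1 / 6.

Let A : set (n.-tuple (measurableTypeR R)) := [set y | pi * sqn y < 99 / 100 * m].

Let m0 : 0 <= m. Proof. by rewrite divr_ge0. Qed.

Let exp_le_q (u : R) : u <= - (6 / 1000 / 1000) -> expR (m * u) <= q.
Proof. by move=> u6; rewrite ler_expR -mulrN; exact: ler_wpM2l. Qed.

Let mpisqn : measurable_fun setT (fun y : n.-tuple (measurableTypeR R) => pi * sqn y).
Proof. by apply: measurable_funM => //; exact: measurable_sqn. Qed.

Let mpisqd x : measurable_fun setT (fun y : n.-tuple (measurableTypeR R) => pi * sqd x y).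
Proof. by apply: measurable_funM => //; exact: measurable_sqd. Qed.

Let mA : measurable A. Proof. exact: measurable_lt_cst. Qed.

(** The exponent [t (1 - alpha) + t^2] is minimal at [t = (alpha - 1) / 2], which is the value used
    in each application. *)
Lemma gaussian_radial_tail (t alpha : R) (S : set (n.-tuple (measurableTypeR R))) :
  measurable S -> `|t| <= 1 / 4 ->
  (forall y, S y -> t * (alpha * m) <= t * (pi * sqn y)) ->
  (gaussian_Rn R n S <= (expR (m * (t + t ^+ 2 - t * alpha)))%:E)%E.
Proof.
move=> mS t4 hS; pose x : n.-tuple (measurableTypeR R) := [tuple of nseq n 0].
have /andP[tl tu] : - (1 / 4) <= t <= 1 / 4 by rewrite -ler_norml.
rewrite (gaussian_RnE x).
apply: (@le_trans _ _ (expR (- (t * alpha * m)) * gauss2_mass (1 - t) 0 x)%:E).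
  apply: le_integral_gauss2_mass => //; last by lra.
  by move=> y /hS; lra.
rewrite lee_fin; apply: (le_trans (ler_wpM2l (expR_ge0 _) (gauss2_mass_radial_le _ t4))).
by rewrite -expRD ler_expR; lra.
Qed.

Lemma gaussian_inner_ball : (gaussian_Rn R n A <= q%:E)%E.
Proof.
apply: (le_trans (@gaussian_radial_tail (- (1 / 200)) (99 / 100) A mA _ _)).
- by rewrite normrN ger0_norm; lra.
- by move=> y; rewrite /A/=; lra.
- by rewrite lee_fin; apply: exp_le_q; lra.
Qed.

(** Each of the two tails [S1], [S2] has mass at most [q <= 1 / 6]. *)
Lemma gaussian_shell :
  ((1 / 2)%:E <= gaussian_Rn R n [set x | (`|pi * sqn x - m| <= 1 / 200 * m)%R])%E.
Proof.
set S := [set _ | _].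
have mS : measurable S.
  have -> : S = ~` [set x | 1 / 200 * m < `|pi * sqn x - m|].
    by apply/seteqP; split => y; rewrite /S/= leNgt => /negP.
  apply: measurableC.
  have -> : [set x : n.-tuple (measurableTypeR R) | 1 / 200 * m < `|pi * sqn x - m|] =
      [set x | - `|pi * sqn x - m| < - (1 / 200 * m)].
    by apply/seteqP; split => y /=; rewrite ltrN2.
  apply: measurable_lt_cst; apply: measurableT_comp => //; apply: measurableT_comp => //.
  exact: measurable_funB.
pose S1 : set (n.-tuple (measurableTypeR R)) := [set y | 201 / 200 * m <= pi * sqn y].
pose S2 : set (n.-tuple (measurableTypeR R)) := [set y | pi * sqn y < 199 / 200 * m].
have mS1 : measurable S1 by exact: measurable_ge_cst.
have mS2 : measurable S2 by exact: measurable_lt_cst.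
have S1q : (gaussian_Rn R n S1 <= q%:E)%E.
  apply: (le_trans (@gaussian_radial_tail (1 / 400) (201 / 200) S1 mS1 _ _)).
  - by rewrite ger0_norm; lra.
  - by move=> y; rewrite /S1/=; lra.
  (* The exponent is [- m / 160000]; the two shell tails are the weakest estimates and dictate the
     constant in [q]. *)
  - by rewrite lee_fin; apply: exp_le_q; lra.
have S2q : (gaussian_Rn R n S2 <= q%:E)%E.
  apply: (le_trans (@gaussian_radial_tail (- (1 / 400)) (199 / 200) S2 mS2 _ _)).
  - by rewrite normrN ger0_norm; lra.
  - by move=> y; rewrite /S2/=; lra.
  - by rewrite lee_fin; apply: exp_le_q; lra.
have cover : setT `<=` S `|` (S1 `|` S2).
  move=> y _; rewrite /S /S1 /S2 /=.
  have [h1|h1] := leP (201 / 200 * m) (pi * sqn y); first by right; left.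
  have [h2|h2] := ltP (pi * sqn y) (199 / 200 * m); first by right; right.
  by left; rewrite ler_norml; lra.
have : (1%:E <= gaussian_Rn R n S + (q%:E + q%:E))%E.
  rewrite -(gaussian_Rn_setT R n); apply: (le_trans (gaussian_Rn_subset cover)).
  apply: (le_trans (measureU2 _ _ _)) => //; first exact: measurableU.
  rewrite leeD2l//; apply: (le_trans (measureU2 _ _ _)) => //.
  exact: leeD.
case: (gaussian_Rn R n S) => [r||]//.
  by rewrite -!EFinD !lee_fin; have := q6; lra.
by move=> _; rewrite leey.
Qed.

(** * The ball [D] around a typical point *)

Section off_center_ball.
Variable x : n.-tuple (measurableTypeR R).
Hypothesis x_shell : `|pi * sqn x - m| <= 1 / 200 * m.

Let D : set (n.-tuple (measurableTypeR R)) := [set y | pi * sqd x y < 76 / 100 * m].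
Let mD : measurable D. Proof. exact: measurable_lt_cst. Qed.

Let M := gauss2_mass 1 1 x.
Let M0 : 0 < M. Proof. by apply: gauss2_mass_gt0; lra. Qed.

(** Passing to the tilted weight on [D] costs [exp(0.76 m)], but the complement of [A] is a large
    deviation for the tilted measure and gains [exp(- 0.0282 m)]. The net exponent is below
    [0.74 m]. *)
Let outside : (gaussian_Rn R n (D `\` A) <= (expR (74 / 100 * m) * M / 2)%:E)%E.
Proof.
have mDA : measurable (D `\` A) by exact: measurableD.
rewrite (gaussian_RnE x).
(* The double negation comes from using the comparison with the negative constant [c = - 0.76 m]. *)
apply: (@le_trans _ _ ((expR (- (- (76 / 100 * m))))%:E *
    \int[lebesgue_Rn R n]_(y in D `\` A) (gauss2 1 1 x y)%:E)%E).
  apply: le_integral_gauss2 => // y [+ _]; rewrite /D/=; lra.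
apply: (@le_trans _ _ ((expR (- (- (76 / 100 * m))))%:E * (M * expR (m *
    (3 / 2 * (12 / 100) + 2 * (12 / 100) ^+ 2 + 1 / 200 * `|12 / 100|
     - 2 * (12 / 100) * (99 / 100))))%:E)%E).
  rewrite lee_pmul2l ?fin_numE// ?lte_fin ?expR_gt0//.
  apply: tilted_sqn_tail => //; first by rewrite ger0_norm; lra.
  by move=> y [_]; rewrite /A/= => /negP; rewrite -leNgt; lra.
rewrite -EFinM lee_fin opprK mulrCA -expRD ger0_norm; last by lra.
rewrite [leRHS]mulrAC [leRHS]mulrC.
apply: ler_wpM2l; first exact: ltW.
have : expR (m * - (6 / 1000 / 1000)) <= 1 / 6 by rewrite mulrN.
move=> h; apply: (@le_trans _ _ (expR (74 / 100 * m + m * - (6 / 1000 / 1000)))).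
  by rewrite ler_expR; have := m0; lra.
by rewrite expRD; apply: ler_wpM2l; [exact: expR_ge0|lra].
Qed.

(** Under the tilted measure, most mass lies in [A] and in the thin shell
    [0.74 m <= pi |x - y|^2 < 0.76 m]; there the Gaussian density is at least [exp(0.74 m)] times
    the tilted one. *)
Let inside : ((expR (74 / 100 * m) * M / 2)%:E <= gaussian_Rn R n (D `&` A))%E.
Proof.
pose T1 : set (n.-tuple (measurableTypeR R)) := [set y | 76 / 100 * m <= pi * sqd x y].
pose T2 : set (n.-tuple (measurableTypeR R)) := [set y | pi * sqd x y < 74 / 100 * m].
have mT1 : measurable T1 by exact: measurable_ge_cst.
have mT2 : measurable T2 by exact: measurable_lt_cst.
have mAC : measurable (~` A) by exact: measurableC.
have mDA : measurable (D `&` A) by exact: measurableI.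
pose D' := (D `&` A) `\` T2.
have mD' : measurable D' by exact: measurableD.
pose K S := (\int[lebesgue_Rn R n]_(y in S) (gauss2 1 1 x y)%:E)%E.
have K1 : (K T1 <= (M * q)%:E)%E.
  apply: (le_trans
    (@tilted_sqd_tail _ _ x (1 / 200) (1 / 250) (76 / 100) T1 mT1 _ x_shell _)).
  - by rewrite ger0_norm; lra.
  - by move=> y; rewrite /T1/=; lra.
  - rewrite lee_fin; apply: ler_wpM2l; first exact: ltW.
    apply: exp_le_q.
    by rewrite ger0_norm; lra.
have K2 : (K T2 <= (M * q)%:E)%E.
  apply: (le_trans
    (@tilted_sqd_tail _ _ x (1 / 200) (- (1 / 250)) (74 / 100) T2 mT2 _ x_shell _)).
  - by rewrite normrN ger0_norm; lra.
  - by move=> y; rewrite /T2/=; lra.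
  - rewrite lee_fin; apply: ler_wpM2l; first exact: ltW.
    apply: exp_le_q.
    by rewrite normrN ger0_norm; lra.
have K3 : (K (~` A) <= (M * q)%:E)%E.
  apply: (le_trans
    (@tilted_sqn_tail _ _ x (1 / 200) (12 / 100) (99 / 100) (~` A) mAC _ x_shell _)).
  - by rewrite ger0_norm; lra.
  - by move=> y; rewrite /A/= => /negP; rewrite -leNgt; lra.
  - rewrite lee_fin; apply: ler_wpM2l; first exact: ltW.
    apply: exp_le_q.
    by rewrite ger0_norm; lra.
(* The space is the good set [D'] and three exceptional sets, each of tilted mass at most
   [M * q]. *)
have cover : setT = D' `|` (T1 `|` (T2 `|` ~` A)).
  apply/seteqP; split => // y _.
  have [yA|] := pselect (A y); last by right; right; right.
  have [yT2|yT2] := pselect (T2 y); first by right; right; left.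
  have [yD|yD] := pselect (D y); first by left.
  by right; left; move: yD => /negP; rewrite -leNgt.
have mg : measurable_fun setT (fun y => (gauss2 1 1 x y)%:E).
  by apply/measurable_EFinP; exact: measurable_gauss2.
have g0 y : (0 <= (gauss2 1 1 x y)%:E)%E by rewrite lee_fin gauss2_ge0.
have : (M%:E <= K D' + ((M * q)%:E + ((M * q)%:E + (M * q)%:E)))%E.
  rewrite -(@integral_gauss2 R n 1 1 x); last by lra.
  rewrite cover.
  apply: (le_trans (ge0_integral_setU_le _ _ _ _ _)) => //.
    by do ?apply: measurableU.
  rewrite leeD2l//.
  apply: (le_trans (ge0_integral_setU_le _ _ _ _ _)) => //.
    by apply: measurableU.
  rewrite leeD//.
  apply: (le_trans (ge0_integral_setU_le _ _ _ _ _)) => //.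
  by rewrite leeD.
have KD' : (K D' <= (expR (- (74 / 100 * m)))%:E * gaussian_Rn R n (D `&` A))%E.
  rewrite (gaussian_RnE x).
  apply: (@le_trans _ _ ((expR (- (74 / 100 * m)))%:E *
      \int[lebesgue_Rn R n]_(y in D') (gauss2 1 0 x y)%:E)%E).
    apply: le_integral_gauss2 => // y [_]; rewrite /T2/= => /negP; rewrite -leNgt; lra.
  rewrite lee_pmul2l ?fin_numE// ?lte_fin ?expR_gt0//.
  apply: ge0_subset_integral => //.
  - by apply/measurable_funTS/measurable_EFinP; exact: measurable_gauss2.
  - by move=> y _; rewrite lee_fin gauss2_ge0.
  - by move=> y [].
move=> h; have {h KD'} := le_trans h (leeD2r _ KD').
case: (gaussian_Rn R n (D `&` A)) => [r||].
- rewrite -EFinM -!EFinD !lee_fin => h.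
  have : M / 2 <= expR (- (74 / 100 * m)) * r.
    (* The bound [1 / 6] on [q] is what makes the three exceptional sets cost at most [M / 2]
       together. *)
    have : M * q <= M * (1 / 6) by apply: ler_wpM2l; [exact: ltW|exact: q6].
    by have := M0; move: h; lra.
  by rewrite expRN [X in _ <= X -> _]mulrC ler_pdivlMr ?expR_gt0 //; lra.
- by rewrite leey.
- by rewrite gt0_muleNy ?lte_fin ?expR_gt0// addNye.
Qed.

(** [inside] and [outside] compare the two pieces of [D] with the same positive number, so the piece
    in [A] is the larger one. *)
Lemma off_center_ball_average :
  (0 < gaussian_Rn R n D /\
  (1 / 2)%:E <= (gaussian_Rn R n D)^-1 * gaussian_Rn R n (A `&` D))%E.
Proof.
have D1 : (gaussian_Rn R n D <= 1)%E.
  by rewrite -(gaussian_Rn_setT R n); exact: gaussian_Rn_subset.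
have DU : gaussian_Rn R n D = (gaussian_Rn R n (D `&` A) + gaussian_Rn R n (D `\` A))%E.
  by rewrite addeC; exact: measureDI.
have := inside; have := outside; move: D1; rewrite DU (setIC A).
have e0 : 0 < expR (74 / 100 * m) * M / 2 by rewrite !mulr_gt0 ?expR_gt0.
have : (0 <= gaussian_Rn R n (D `\` A))%E by exact: measure_ge0.
case: (gaussian_Rn R n (D `&` A)) => [r||]//; case: (gaussian_Rn R n (D `\` A)) => [s||]//.
rewrite -EFinD !lee_fin lte_fin => s0 rs1 h1 h2.
have rs0 : 0 < r + s by lra.
split => //; rewrite inver gt_eqF// -EFinM lee_fin [leRHS]mulrC ler_pdivlMr//; lra.
Qed.

End off_center_ball.

End large_dimension.

(** * Lower bounds for the weak type constant *)

Section indicators.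
Context {R : realType} {n : nat}.
Variable mu : {measure set (n.-tuple (measurableTypeR R)) -> \bar R}.

Lemma maximal_indic_ge (S : set (n.-tuple (measurableTypeR R))) x (r : R) :
  measurable S -> measurable (eball x r) -> 0 < r -> (0 < mu (eball x r))%E ->
  ((mu (eball x r))^-1 * mu (S `&` eball x r) <= maximal mu (\1_S) x)%E.
Proof.
move=> mS mB r0 B0; apply: ereal_sup_ubound; exists r => //.
congr (_ * _)%E; rewrite -integral_indic//; apply: eq_integral => y _.
by rewrite ger0_norm ?fun_ge0.
Qed.

(** The test function is an indicator, whose [L^p] norm is the measure of the set to the power
    [1 / p]. *)
Lemma weak_type_bound_indic (p C lambda : R) (S : set (n.-tuple (measurableTypeR R))) :
  weak_type_bound mu p C -> 1 <= p -> 0 < lambda -> measurable S -> (mu S < +oo)%E ->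
  (mu [set y | lambda%:E < maximal mu (\1_S) y] `^ p^-1 <=
   (C / lambda)%:E * mu S `^ p^-1)%E.
Proof.
move=> wC p1 l0 mS Sfin; have p0 : p != 0 by rewrite gt_eqF// (lt_le_trans ltr01).
have NS : ('N[mu]_(p%:E) [EFin \o (\1_S : _ -> R)] = mu S `^ p^-1)%E.
  rewrite unlock; congr (_ `^ _)%E.
  rewrite -(setIT S) -integral_indic// setIT; apply: eq_integral => y _ /=.
  by rewrite indicE; case: (y \in S); rewrite ?normr1 ?normr0 ?powR1 ?powR0.
have LS : (\1_S : _ -> R) \in Lfun mu p%:E.
  rewrite inE; apply/andP; split; rewrite inE/=; first exact: measurable_indic.
  by rewrite /finite_norm NS poweR_lty.
by have := wC lambda _ l0 LS; rewrite NS.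
Qed.

End indicators.

(** Otherwise the space, a countable union of balls about [x], would be negligible, although its
    mass is 1. *)
Lemma gaussian_ball_gt0 (R : realType) n (x : n.-tuple (measurableTypeR R)) :
  exists2 c : R, 0 < c & (0 < gaussian_Rn R n [set y | (pi * sqd x y < c)%R])%E.
Proof.
apply: contrapT => no.
have mB (k : nat) : measurable [set y : n.-tuple (measurableTypeR R) | pi * sqd x y < k.+1%:R].
  by apply: measurable_lt_cst; apply: measurable_funM => //; exact: measurable_sqd.
have B0 (k : nat) : (gaussian_Rn R n [set y | (pi * sqd x y < k.+1%:R)%R] = 0)%E.
  apply/eqP; rewrite eq_le measure_ge0 andbT leNgt; apply/negP => Bk.
  by apply: no; exists k.+1%:R.
have : (gaussian_Rn R n).-negligible (\bigcup_k [set y | pi * sqd x y < k.+1%:R]).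
  by apply: negligible_bigcup => k; apply/negligibleP; [exact: mB|exact: B0].
have -> : \bigcup_k [set y | pi * sqd x y < k.+1%:R] = setT.
  apply/seteqP; split => // y _; exists (Num.truncn (pi * sqd x y)) => //=.
  by apply: truncnS_gt.
move/(negligibleP _ measurableT) => h.
have /eqP : (1 = 0 :> \bar R)%E by rewrite -(gaussian_Rn_setT R n); exact: h.
by rewrite onee_eq0.
Qed.

Section constants.
Context {R : realType} (n : nat) (p C : R).
Hypotheses (p1 : 1 <= p) (wC : weak_type_bound (gaussian_Rn R n) p C).

Let p0 : 0 < p. Proof. exact: lt_le_trans p1. Qed.

(** Test with the constant function 1: its averages equal 1, so at level [1 / 2] the superlevel set
    is everything and [1 <= 2 C]. *)
Lemma weak_type_gaussian_ge_half : 1 / 2 <= C.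
Proof.
have l0 : 0 < 1 / 2 :> R by lra.
pose G : {measure set (n.-tuple (measurableTypeR R)) -> \bar R} := gaussian_Rn R n.
have GT : G setT = 1%E by exact: gaussian_Rn_setT.
have := weak_type_bound_indic wC p1 l0 measurableT.
rewrite -/G GT ltry => /(_ isT).
have -> : [set y | ((1 / 2)%:E < maximal G (\1_setT) y)%E] = setT.
  apply/seteqP; split => // x _ /=.
  have [c c0 cB] := gaussian_ball_gt0 x.
  have cpi : 0 < Num.sqrt (c / pi) by rewrite sqrtr_gt0 divr_gt0// pi_gt0.
  have mB : measurable (eball x (Num.sqrt (c / pi))).
    rewrite eball_sqrt//; apply: measurable_lt_cst; apply: measurable_funM => //.
    exact: measurable_sqd.
  rewrite -eball_sqrt// in cB.
  have := maximal_indic_ge measurableT mB cpi cB; apply: lt_le_trans.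
  have Bfin : (gaussian_Rn R n (eball x (Num.sqrt (c / pi))) \is a fin_num)%E.
    rewrite ge0_fin_numE//; apply: le_lt_trans (ltry 1).
    by rewrite -(gaussian_Rn_setT R n); exact: gaussian_Rn_subset.
  rewrite setTI muleC divee// ?gt_eqF//.
  by rewrite lte_fin; lra.
rewrite GT poweR1r mule1 lee_fin ler_pdivlMr//.
by lra.
Qed.

(** Testing the indicator of [A] at level [1 / 4], below the average [1 / 2], gives
    [1 / 2 <= 4 C q^(1 / p)]. *)
Lemma weak_type_gaussian_ge_exp :
  expR (- (n%:R / 2 * (6 / 1000 / 1000))) <= 1 / 6 :> R ->
  1 / 8 * expR (6 / 1000 / 1000 / 2) `^ (n%:R / p) <= C.
Proof.
set q := expR _ => q6.
pose A : set (n.-tuple (measurableTypeR R)) := [set y | pi * sqn y < 99 / 100 * (n%:R / 2)].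
have mA : measurable A.
  by apply: measurable_lt_cst; apply: measurable_funM => //; exact: measurable_sqn.
(* For [n = 0] the left side of the hypothesis would be 1. *)
have n0 : 0 < n%:R / 2 :> R.
  rewrite divr_gt0// ltr0n lt0n; apply/eqP => n0.
  by move: q6; rewrite /q n0 !mul0r oppr0 expR0; lra.
have Aq : (gaussian_Rn R n A <= q%:E)%E by exact: gaussian_inner_ball.
have l0 : 0 < 1 / 4 :> R by lra.
have := weak_type_bound_indic wC p1 l0 mA (le_lt_trans Aq (ltry _)).
set B := [set _ | _].
have shellB : [set x | `|pi * sqn x - n%:R / 2| <= 1 / 200 * (n%:R / 2)] `<=` B.
  move=> x xs; rewrite /B/=.
  have [D0 hD] := off_center_ball_average q6 xs.
  have c0 : 0 < 76 / 100 * (n%:R / 2) :> R by rewrite mulr_gt0//; lra.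
  have cpi : 0 < Num.sqrt (76 / 100 * (n%:R / 2) / pi) :> R.
    by rewrite sqrtr_gt0 divr_gt0// pi_gt0.
  rewrite -eball_sqrt// in D0 hD.
  apply: (lt_le_trans _ (maximal_indic_ge mA _ cpi D0)).
    by apply: lt_le_trans hD; rewrite lte_fin; lra.
  rewrite eball_sqrt//; apply: measurable_lt_cst; apply: measurable_funM => //.
  exact: measurable_sqd.
have halfB : ((1 / 2)%:E <= gaussian_Rn R n B)%E.
  exact: le_trans (gaussian_shell q6) (gaussian_Rn_subset shellB).
have pV0 : 0 <= p^-1 by rewrite invr_ge0 ltW.
have pV1 : p^-1 <= 1 by rewrite invf_le1.
(* The sign of [C] is needed to multiply the bound on the mass of [A] by [C / lambda]. *)
have C0 : 0 <= C by apply: le_trans weak_type_gaussian_ge_half; lra.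
(* As [1 / p <= 1], the power only increases [1 / 2]; this keeps the constant independent of [p]. *)
have half_le : ((1 / 2)%:E <= gaussian_Rn R n B `^ p^-1)%E.
  apply: (@le_trans _ _ ((1 / 2)%:E `^ p^-1)%E).
    rewrite poweR_EFin lee_fin -[leLHS]powRr1; last by lra.
    by apply: ger_powR => //; lra.
  apply: gt0_ler_poweR => //; rewrite in_itv/= leey andbT; first by rewrite lee_fin; lra.
  exact: measure_ge0.
move=> h; have {h} := le_trans half_le h.
have : (gaussian_Rn R n A `^ p^-1 <= q%:E `^ p^-1)%E.
  by apply: gt0_ler_poweR => //; rewrite in_itv/= leey andbT ?lee_fin ?expR_ge0 ?measure_ge0.
move=> h1 h2; have {h1 h2} := le_trans h2 (lee_wpmul2l _ h1).
rewrite poweR_EFin -EFinM !lee_fin divr_ge0// => /(_ isT).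
rewrite /q -!expRM => h.
have -> : expR (6 / 1000 / 1000 / 2 * (n%:R / p)) =
  (expR (- (n%:R / 2 * (6 / 1000 / 1000)) * p^-1))^-1.
  by rewrite -expRN; congr expR; ring.
rewrite ler_pdivrMr ?expR_gt0//; lra.
Qed.

End constants.

Theorem theorem2p8 (R : realType) :
  exists a c : R, [/\ 1 < a, 0 < c &
    forall (n : nat) (p : R), (1 <= n)%N -> 1 <= p ->
      ((c * a `^ (n%:R / p))%:E <= weak_type_const (gaussian_Rn R n) p)%E].
Proof.
pose k : R := 6 / 1000 / 1000 / 2.
have k0 : 0 < k by rewrite /k; lra.
(* For [n >= N] one has [n k >= 5], hence [exp(n k) >= 1 + 5 = 6], which is the smallness condition
   on [q]. *)
pose N : nat := Num.bound (5 / k).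
have NP : 5 / k < N%:R by apply: archi_boundP; rewrite divr_ge0// ltW.
(* The factor [exp(- N k)] absorbs [a^(n / p)] for [n < N], where only the bound [1 / 2] is
   available. *)
exists (expR k), (1 / 8 * expR (- (N%:R * k))); split.
- by rewrite expR_gt1.
- by rewrite mulr_gt0 ?expR_gt0//; lra.
(* It suffices to bound every admissible [C] from below; if there is none, the infimum is
   infinite. *)
move=> n p _ p1; apply: le_ereal_inf_tmp => _ [C [C0 wC] <-]; rewrite lee_fin.
have p0 : 0 < p by exact: lt_le_trans p1.
have [nN|Nn] := ltnP n N.
  apply: le_trans (weak_type_gaussian_ge_half p1 wC).
  rewrite -expRM -[leLHS]mulrA -expRD.
  suff : expR (- (N%:R * k) + k * (n%:R / p)) <= 1 by lra.
  rewrite expR_le1 addrC subr_le0 [leRHS]mulrC ler_pM2l// ler_pdivrMr//.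
  by rewrite (@le_trans _ _ N%:R) ?ler_nat 1?ltnW// ler_peMr.
apply: le_trans (weak_type_gaussian_ge_exp p1 wC _); last first.
  have kn : 5 <= n%:R * k.
    rewrite -ler_pdivrMr//; apply: le_trans (ltW NP) _.
    by rewrite ler_nat.
  have e6 : 6 <= expR (n%:R * k) by apply: le_trans (expR_ge1Dx _); lra.
  have -> : n%:R / 2 * (6 / 1000 / 1000) = n%:R * k by rewrite /k; field.
  rewrite expRN -[leLHS]mul1r ler_pdivrMr ?expR_gt0//; lra.
apply: ler_wpM2r; first exact: powR_ge0.
suff : expR (- (N%:R * k)) <= 1 by lra.
by rewrite expR_le1 oppr_le0 mulr_ge0// ltW.
Qed.
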